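(* The minimum of $\Lambda$ on $S^{d-1}$, which equals $0$, is attained at some $\xi\in\mathcal P$, where $$\Lambda(\varsigma)=\frac{\sum_{\nu\in\mathcal V}\beta(\nu)|\nu\cdot\varsigma|-|\mathbf e_1\cdot\varsigma|\,\beta_A}{|\varsigma|},\qquad \varsigma\in\mathbb R^d\setminus\{0\}.$$
   Context: Let $d\ge2$, let $v_1,\dots,v_d\in\mathbb R^d$ be linearly independent, $A=(v_1,\dots,v_d)$ with $\det A>0$. Let $\mathcal Z=A\{-\frac12,\frac12\}^d$ be the corners of the unit cell, $\mathcal V=A\{-1,0,1\}^d\setminus\{0\}$ the set of interaction directions, and $\mathcal V_k=\{At:t\in\{-1,0,1\}^d\text{ with exactly }k\text{ nonzero entries}\}$. The set of normals to crystallographic hyperplanes is $$\mathcal P=\{\xi\in S^{d-1}:\exists u_1,\dots,u_{d-1}\in\mathcal V,\ \mathrm{span}\{u_1,\dots,u_{d-1}\}=\xi^\perp\}.$$ Interaction constants: $\beta(z_s,z_t)=\beta(z_t,z_s)\ge0$ for $z_s\neq z_t$ in $\mathcal Z$ are given such that for every partition $\mathcal Z=\mathcal Z_1\dot\cup\dots\dot\cup\mathcal Z_n$ with $n\ge2$ one has $\sum_{i\neq j}\sum_{z_s\in\mathcal Z_i}\sum_{z_t\in\mathcal Z_j}\beta(z_s,z_t)>0$; and for each $1\le k\le d$, $\nu\in\mathcal V_k$ there is $\beta(\nu)\ge0$ with $\frac12\beta(z_s,z_t)=2^{k-d}\beta(\nu)$ for all $z_s,z_t\in\mathcal Z$ with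 $z_s-z_t=\nu$. (In particular $\beta(\nu)=\beta(-\nu)$.) Finally $$\beta_A=\min_{\xi\in\mathbb R^d\setminus\{0\}}\frac{\sum_{\nu\in\mathcal V}\beta(\nu)|\nu\cdot\xi|}{|\mathbf e_1\cdot\xi|},$$ the quotient being understood as $+\infty$ if $\mathbf e_1\cdot\xi=0$. *)

(* Defs.v *)
From HB Require Import structures.
From mathcomp Require Import all_boot all_order all_algebra finmap.
From mathcomp Require Import all_classical all_reals all_analysis.
Set Implicit Arguments.
Unset Strict Implicit.
Unset Printing Implicit Defensive.
Import Order.TTheory GRing.Theory Num.Theory.
Local Open Scope classical_set_scope.
Local Open Scope ring_scope.

(* The library norm `|x| on 'cV[R]_d is the sup norm, hence the explicit
   Euclidean structure. *)
Definition dotv (R : realType) (d : nat) (u w : 'cV[R]_d) : R :=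
  \sum_i u i 0 * w i 0.

Definition enorm (R : realType) (d : nat) (u : 'cV[R]_d) : R :=
  Num.sqrt (dotv u u).

Definition sphere (R : realType) (d : nat) : set 'cV[R]_d :=
  [set xi | enorm xi = 1].

(* First vector of the standard basis; coordinates are numbered from 0. *)
Definition e1 (R : realType) (d : nat) : 'cV[R]_d :=
  \col_i ((i : nat) == 0%N)%:R.

(* The set S^d of column vectors with all entries in S. *)
Definition vec_over (R : realType) (d : nat) (S : {fset R}) : {fset 'cV[R]_d} :=
  [fset x in [seq (\col_i val (f i))%R | f : {ffun 'I_d -> S}]]%fset.

Definition corners (R : realType) (d : nat) (A : 'M[R]_d) : {fset 'cV[R]_d} :=
  [fset A *m t | t in vec_over d [fset - (1 / 2); 1 / 2]]%fset.

Definition directions (R : realType) (d : nat) (A : 'M[R]_d) :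
    {fset 'cV[R]_d} :=
  ([fset A *m t | t in vec_over d [fset -1; 0; 1]] `\ 0)%fset.

Definition directions_k (R : realType) (d : nat) (A : 'M[R]_d) (k : nat) :
    {fset 'cV[R]_d} :=
  [fset A *m t | t in vec_over d [fset -1; 0; 1]
               & #|[set i | t i ord0 != 0]%SET| == k]%fset.

Definition cryst_normals (R : realType) (d : nat) (A : 'M[R]_d) :
    set 'cV[R]_d :=
  [set xi | sphere xi /\
    exists2 u : (d.-1).-tuple 'cV[R]_d,
      {subset u <= directions A} &
      [set w | w \in <<u>>%VS] = [set w | dotv w xi = 0]].

Definition surface_energy (R : realType) (d : nat) (A : 'M[R]_d)
    (beta : 'cV[R]_d -> R) (xi : 'cV[R]_d) : R :=
  \sum_(nu <- directions A) beta nu * `|dotv nu xi|.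

Definition energy_ratio (R : realType) (d : nat) (A : 'M[R]_d)
    (beta : 'cV[R]_d -> R) (xi : 'cV[R]_d) : \bar R :=
  if dotv (e1 R d) xi == 0 then +oo%E
  else (surface_energy A beta xi / `|dotv (e1 R d) xi|)%:E.

(* The minimum is rendered as an infimum, so that its attainment is not
   presupposed; the infimum is finite for d >= 1 and beta >= 0. *)
Definition beta_A (R : realType) (d : nat) (A : 'M[R]_d)
    (beta : 'cV[R]_d -> R) : R :=
  fine (ereal_inf [set energy_ratio A beta xi | xi in [set xi | xi != 0]]).

Definition Lambda (R : realType) (d : nat) (A : 'M[R]_d)
    (beta : 'cV[R]_d -> R) (s : 'cV[R]_d) : R :=
  (surface_energy A beta s - `|dotv (e1 R d) s| * beta_A A beta) / enorm s.

(* Main.v *)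
(** Minimizing the energy-to-[e1] ratio amounts to minimizing the convex,
    piecewise linear energy on the hyperplane [dotv e1 x = 1]. If the
    interaction directions orthogonal to [x] do not span a hyperplane, some
    [y <> 0] is orthogonal to them and to [e1]; moving along [y] or [- y] does
    not increase the energy until a further direction becomes orthogonal. So
    the minimum may be taken over the vertices, the points [x] whose orthogonal
    directions together with [e1] span the space. A vertex is determined by its
    set of orthogonal directions, so there are finitely many of them and the
    minimum is attained; a normalized vertex is a crystallographic normal. *)
Require Import Defs.
From HB Require Import structures.
From mathcomp Require Import all_boot all_order all_algebra finmap.
From mathcomp Require Import all_classical all_reals all_analysis.
From mathcomp Require Import ring.
Set Implicit Arguments.
Unset Strict Implicit.
Unset Printing Implicit Defensive.
Import Order.TTheory GRing.Theory Num.Theory.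
Local Open Scope classical_set_scope.
Local Open Scope ring_scope.

(** * The Euclidean inner product and orthogonality to a span *)

Section Dot.
Context {R : realType} {d : nat}.
Implicit Types u v w : 'cV[R]_d.

Lemma dotvC u v : dotv u v = dotv v u.
Proof. by apply: eq_bigr => i _; rewrite mulrC. Qed.

Lemma dotvDr u v w : dotv u (v + w) = dotv u v + dotv u w.
Proof.
by rewrite -big_split; apply: eq_bigr => i _; rewrite mxE mulrDr.
Qed.

Lemma dotvZr (c : R) u v : dotv u (c *: v) = c * dotv u v.
Proof.
by rewrite /dotv big_distrr; apply: eq_bigr => i _; rewrite mxE mulrCA.
Qed.

Lemma dotvNr u v : dotv u (- v) = - dotv u v.
Proof. by rewrite -scaleN1r dotvZr mulN1r. Qed.

Lemma dotvBr u v w : dotv u (v - w) = dotv u v - dotv u w.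
Proof. by rewrite dotvDr dotvNr. Qed.

Lemma dotv0r u : dotv u 0 = 0.
Proof. by rewrite -(scale0r u) dotvZr mul0r. Qed.

Lemma dotv_gt0 u : u != 0 -> 0 < dotv u u.
Proof.
move=> u0; rewrite lt_neqAle eq_sym.
have h i : true -> 0 <= u i 0 * u i 0 by rewrite -expr2 sqr_ge0.
rewrite (sumr_ge0 _ h) andbT; apply: contra u0.
rewrite psumr_eq0 // => /allP h0; apply/eqP/colP => i.
by have := h0 i (mem_index_enum _); rewrite mulf_eq0 orbb mxE => /eqP.
Qed.

Lemma enorm_gt0 u : u != 0 -> 0 < enorm u.
Proof. by move=> u0; rewrite sqrtr_gt0 dotv_gt0. Qed.

Lemma enorm_normalize u : u != 0 -> enorm ((enorm u)^-1 *: u) = 1.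
Proof.
move=> /enorm_gt0 u0; have uE : dotv u u = enorm u ^+ 2.
  by rewrite sqr_sqrtr // ltW // -sqrtr_gt0.
move: (enorm u) u0 uE => c c0 uE.
by rewrite /enorm dotvZr dotvC dotvZr uE expr2 mulKf ?mulVf ?sqrtr1 // gt_eqF.
Qed.

Lemma span_orthogonal (s : seq 'cV[R]_d) v w :
  {in s, forall u, dotv u v = 0} -> w \in << s >>%VS -> dotv w v = 0.
Proof.
move=> sv ws; rewrite (coord_span (X := in_tuple s) ws) dotvC.
elim/big_ind: _ => [|x y x0 y0|i _]; rewrite ?dotv0r ?dotvDr ?x0 ?y0 ?addr0 //.
by rewrite dotvZr dotvC sv ?mulr0 // mem_nth // -(size_tuple (in_tuple s)).
Qed.

(** A basis of the span has fewer than [d] members, so the matrix with these columns has a nonzero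
    left kernel; a kernel row transposes to the required vector. *)
Lemma exists_orthogonal (s : seq 'cV[R]_d) :
  << s >>%VS != fullv -> exists2 v, v != 0 & {in s, forall u, dotv u v = 0}.
Proof.
move=> sN; pose n := \dim << s >>%VS.
have n_lt : (n < d)%N.
  have -> : d = \dim (fullv : {vspace 'cV[R]_d}) by rewrite dimvf /dim /= muln1.
  by rewrite ltnNge; apply: contra sN => dn; rewrite eqEdim subvf.
pose b := vbasis << s >>%VS.
pose B := \matrix_(j < d, i < n) (b`_i) j 0.
have : kermx B != 0.
  by rewrite -mxrank_eq0 mxrank_ker subn_eq0 -ltnNge (leq_ltn_trans (rank_leq_col _)).
case/rowV0Pn => x /sub_kermxP xB x0; exists x^T.
  by rewrite -trmx0 (inj_eq trmx_inj).
move=> u us; apply: (@span_orthogonal b) => [w /(nthP 0)[i]|]; last first.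
  by rewrite (span_basis (vbasisP _)) memv_span.
rewrite size_tuple => i_n <-; rewrite dotvC.
have /rowP/(_ (Ordinal i_n)) := xB; rewrite !mxE.
by apply: etrans; apply: eq_bigr => j _; rewrite !mxE.
Qed.

End Dot.

(** Serves to cut the directions orthogonal to a vertex down to [d.-1] of them, the tuple length in
    [cryst_normals]. *)
Lemma span_free_subseq (K : fieldType) (V : vectType K) (s : seq V) :
  exists t : seq V, [/\ {subset t <= s}, free t & <<t>>%VS = << s >>%VS].
Proof.
elim: s => [|v s [t [ts tf tE]]]; first by exists [::]; rewrite nil_free.
have sub w : w \in t -> w \in v :: s by move=> /ts; rewrite inE orbC => ->.
have [vs|vs] := boolP (v \in << s >>%VS).
  exists t; split=> //; rewrite span_cons tE; apply/esym/addv_idPr.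
  by rewrite -memvE.
exists (v :: t); split; last by rewrite !span_cons tE.
  by move=> w; rewrite inE => /predU1P[->|/sub//]; rewrite mem_head.
by rewrite free_cons tE vs.
Qed.

(** * Minimizing a weighted sum of absolute inner products on a hyperplane *)

Section WeightedWidth.
Context {R : realType} {d : nat}.
Variables (V : seq 'cV[R]_d) (b : 'cV[R]_d -> R) (e : 'cV[R]_d).
Hypothesis b_ge0 : {in V, forall v, 0 <= b v}.
Hypothesis V_total : forall x, x != 0 -> exists2 v, v \in V & dotv v x != 0.

Let W (x : 'cV[R]_d) := \sum_(v <- V) b v * `|dotv v x|.
Let zeros (x : 'cV[R]_d) := [seq v <- V | dotv v x == 0].
Let vertex x := dotv e x = 1 /\ <<e :: zeros x>>%VS = fullv.

(* [W] is affine along [x + t y] up to the first [t > 0] at which a new inner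
   product vanishes; the slope there is the sum in the first hypothesis. *)
Lemma descend_along x y :
  {in V, forall v, dotv v x = 0 -> dotv v y = 0} ->
  \sum_(v <- V) b v * (Num.sg (dotv v x) * dotv v y) <= 0 ->
  (exists2 v, v \in V & dotv v x * dotv v y < 0) ->
  exists t, W (x + t *: y) <= W x /\
    exists2 v, v \in V & dotv v x != 0 /\ dotv v (x + t *: y) = 0.
Proof.
move=> xy0 slope [v0 v0V v0N].
(* [P] selects the vectors whose inner product with [x + t *: y] moves towards zero as [t] grows
   from 0; [T] is the time at which it vanishes. *)
pose P (i : 'I_(size V)) := dotv V`_i x * dotv V`_i y < 0.
pose T (i : 'I_(size V)) := - (dotv V`_i x / dotv V`_i y).
have i0lt : (index v0 V < size V)%N by rewrite index_mem.
have Pi0 : P (Ordinal i0lt) by rewrite /P /= nth_index.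
case: (Order.TotalTheory.arg_minP T Pi0) => i Pi Tmin.
have quot_lt0 (a c : R) : a * c < 0 -> a / c < 0.
  have [->|c0] := eqVneq c 0; first by rewrite mulr0 ltxx.
  move=> ac; have -> : a / c = a * c / c ^+ 2 by field.
  by rewrite pmulr_llt0 // invr_gt0 exprn_even_gt0.
have Ti : 0 < T i by rewrite oppr_gt0 quot_lt0.
have ci0 : dotv V`_i y != 0.
  by apply: contraTneq Pi; rewrite /P => ->; rewrite mulr0 ltxx.
have ai0 : dotv V`_i x != 0.
  by apply: contraTneq Pi; rewrite /P => ->; rewrite mul0r ltxx.
exists (T i); split; last first.
  exists V`_i; first exact: mem_nth.
  by split=> //; rewrite dotvDr dotvZr /T mulNr divfK // subrr.
suff -> : W (x + T i *: y) =
    W x + T i * \sum_(v <- V) b v * (Num.sg (dotv v x) * dotv v y).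
  by rewrite gerDl pmulr_rle0.
rewrite big_distrr -big_split /=; apply: eq_big_seq => v vV.
rewrite dotvDr dotvZr mulrCA -mulrDr; congr (_ * _).
have jlt : (index v V < size V)%N by rewrite index_mem.
(* By minimality of [T i], no inner product changes sign before that time, so each absolute value is
   affine up to there. *)
have := Tmin (Ordinal jlt); rewrite /P {2}/T /= nth_index //.
have := xy0 _ vV; move: (dotv v x) (dotv v y) (T i) Ti => a c t t0 ac0 tle.
have [a0|a0|a0] := ltrgtP a 0.
- rewrite ltr0_sg // (ltr0_norm a0) mulN1r mulrN ler0_norm ?opprD //.
  have [c0|c0] := leP c 0.
    by rewrite -oppr_ge0 opprD addr_ge0 // oppr_ge0 ?pmulr_rle0 // ltW.
  have := tle; rewrite nmulr_rlt0 // => /(_ c0).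
  by rewrite -mulNr ler_pdivlMr // -lerBrDl sub0r.
- rewrite gtr0_sg // (gtr0_norm a0) mul1r ger0_norm //.
  have [c0|c0] := leP 0 c; first by rewrite addr_ge0 // ?mulr_ge0 // ltW.
  have := tle; rewrite pmulr_rlt0 // => /(_ c0).
  by rewrite -mulrN -invrN ler_pdivlMr ?oppr_gt0 // mulrN -subr_ge0 opprK.
- by rewrite ac0 // a0 sgr0 !mulr0 !addr0 normr0.
Qed.

(** The slope is odd in [y], so reversing [y] if necessary makes it nonpositive; hence [t] may be
    negative. A member of [V] not orthogonal to [y] is not orthogonal to [x] either, so along [y] or
    [- y] some inner product reaches zero. *)
Lemma descend_step x y : y != 0 ->
  {in V, forall v, dotv v x = 0 -> dotv v y = 0} ->
  exists t, W (x + t *: y) <= W x /\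
    exists2 v, v \in V & dotv v x != 0 /\ dotv v (x + t *: y) = 0.
Proof.
wlog slope : y / \sum_(v <- V) b v * (Num.sg (dotv v x) * dotv v y) <= 0.
  move=> wl y0 xy0.
  have [|slope] := leP (\sum_(v <- V) b v * (Num.sg (dotv v x) * dotv v y)) 0.
    by move=> ?; apply: wl.
  have [||v vV /(xy0 _ vV) vy|t] := wl (- y); rewrite ?oppr_eq0 //.
  - rewrite -oppr_ge0 -sumrN ltW // (lt_le_trans slope) // ler_sum // => v _.
    by rewrite dotvNr !mulrN opprK.
  - by rewrite dotvNr vy oppr0.
  - by rewrite scalerN -scaleNr; exists (- t).
move=> y0 xy0.
have [[v vV vN]|noneg] := pselect (exists2 v, v \in V & dotv v x * dotv v y < 0).
  by apply: descend_along => //; exists v.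
have pos v : v \in V -> 0 <= dotv v x * dotv v y.
  by move=> vV; rewrite leNgt; apply/negP => vN; apply: noneg; exists v.
(* All terms of the slope are nonnegative, so it vanishes and the direction
   can be reversed. *)
have [|||t] := @descend_along x (- y).
- by move=> v vV /(xy0 _ vV) vy; rewrite dotvNr vy oppr0.
- rewrite -oppr_ge0 -sumrN big_seq sumr_ge0 // => v vV.
  rewrite dotvNr !mulrN opprK mulr_ge0 ?b_ge0 //.
  have := pos v vV; have := xy0 v vV.
  move: (dotv v x) (dotv v y) => a c ac0.
  have [a0|a0|->] := ltrgtP a 0; last by rewrite sgr0 mul0r.
    by rewrite ltr0_sg // nmulr_rge0 // mulN1r oppr_ge0.
  by rewrite gtr0_sg // pmulr_rge0 // mul1r.
- have [v vV vy] := V_total y0; exists v => //.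
  rewrite dotvNr mulrN oppr_lt0 lt_neqAle pos // andbT eq_sym.
  by rewrite mulf_neq0 //; apply: contra vy => /eqP/(xy0 _ vV)->.
by rewrite scalerN -scaleNr; exists (- t).
Qed.

(** Induction on the number of members of [V] not orthogonal to [x]: a descent step keeps the
    orthogonal ones and gains at least one. *)
Lemma exists_vertex_le x : dotv e x = 1 -> exists2 z, vertex z & W z <= W x.
Proof.
have [n] := ubnP (count (fun v => dotv v x != 0) V).
elim: n x => // n IHn x; rewrite ltnS => xn ex.
have [full|/exists_orthogonal[y y0 ey]] := eqVneq <<e :: zeros x>>%VS fullv.
  by exists x.
have xy0 : {in V, forall v, dotv v x = 0 -> dotv v y = 0}.
  by move=> v vV /eqP vx; apply: ey; rewrite inE mem_filter vx vV orbT.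
have [t [tW [v vV [vx vxt]]]] := descend_step y0 xy0.
have [||z zv zW] := IHn (x + t *: y).
(* Splitting [v] off the vectors counted at [x] gives the strict decrease: all those counted at the
   new point are among the rest. *)
- apply: leq_trans xn; rewrite -[leqRHS]size_filter -(count_predC (pred1 v)).
  rewrite -addn1 addnC leq_add //.
    by rewrite -has_count has_pred1 mem_filter vx.
  rewrite count_filter; set q := predI _ _.
  rewrite [leqLHS](@eq_in_count _ _ (predI [pred u | dotv u (x + t *: y) != 0] q)).
    by apply: sub_count => u /= /andP[].
  move=> u uV; apply/esym/andb_idr => /=.
  have [->|_] := eqVneq u v; first by rewrite vxt eqxx.
  by apply: contra => /eqP ux; rewrite dotvDr dotvZr ux xy0 // mulr0 addr0.
- by rewrite dotvDr dotvZr ex ey ?mem_head // mulr0 addr0.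
by exists z => //; apply: le_trans tW.
Qed.

(** The difference is orthogonal to [e] and to the common zeros, which span the space, hence to
    itself. *)
Lemma vertex_inj x z : vertex x -> vertex z -> zeros x = zeros z -> x = z.
Proof.
move=> [ex fx] [ez fz] xz; apply/eqP; rewrite -subr_eq0; apply/negP => /negP xz0.
have: dotv (x - z) (x - z) = 0.
  apply: (@span_orthogonal _ _ (e :: zeros x)); last by rewrite fx memvf.
  move=> v; rewrite inE => /predU1P[->|vx]; first by rewrite dotvBr ex ez subrr.
  have := vx; rewrite xz mem_filter => /andP[/eqP vz _].
  by move: vx; rewrite mem_filter dotvBr vz => /andP[/eqP-> _]; rewrite subrr.
by apply/eqP; rewrite gt_eqF // dotv_gt0.
Qed.

(** Each vertex is recovered from a boolean pattern on the positions of [V], so the minimum is taken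
    over a finite type. *)
Lemma exists_min_vertex : e != 0 ->
  exists2 z, vertex z & forall x, dotv e x = 1 -> W z <= W x.
Proof.
move=> e0.
pose pat x := [ffun i : 'I_(size V) => dotv V`_i x == 0].
have patP x z : pat x = pat z -> zeros x = zeros z.
  move=> /ffunP xz; apply: eq_in_filter => v vV.
  have ilt : (index v V < size V)%N by rewrite index_mem.
  by have := xz (Ordinal ilt); rewrite !ffunE /= nth_index.
pose P m := `[< exists2 z, vertex z & pat z = m >].
(* The default [0] concerns only patterns of no vertex, which [P] excludes. *)
pose rep m := xget 0 [set z | vertex z /\ pat z = m].
have repP z : vertex z -> rep (pat z) = z.
  move=> zv; have [rv /patP rz] : [set u | vertex u /\ pat u = pat z] (rep (pat z)).
    by apply: (@xgetPex _ 0); exists z.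
  exact: vertex_inj.
have [z0 z0v _] : exists2 z, vertex z & W z <= W ((dotv e e)^-1 *: e).
  by apply: exists_vertex_le; rewrite dotvZr mulVf // gt_eqF // dotv_gt0.
have Pz0 : P (pat z0) by apply/asboolP; exists z0.
case: (Order.TotalTheory.arg_minP (W \o rep) Pz0) => m /asboolP[z zv <-] zmin.
exists z => // x /exists_vertex_le[u uv]; apply: le_trans.
have /zmin : P (pat u) by apply/asboolP; exists u.
by rewrite /= !repP.
Qed.

End WeightedWidth.

(** * Interaction directions, the energy and crystallographic normals *)

Section Directions.
Context {R : realType} {d : nat}.
Implicit Types (A : 'M[R]_d) (b : 'cV[R]_d -> R).

Lemma vec_overP (S : {fset R}) (t : 'cV[R]_d) :
  reflect (forall i, t i 0 \in S) (t \in vec_over d S).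
Proof.
apply: (iffP idP) => [|tS].
  by rewrite in_fset => /mapP[f _ ->] i; rewrite mxE fsvalP.
rewrite in_fset; apply/mapP; exists [ffun i => [` tS i]%fset].
  by rewrite mem_enum.
by apply/colP => i; rewrite mxE ffunE.
Qed.

(** The columns of [A] suffice: a vector orthogonal to all of them lies in the kernel of the
    invertible [A^T]. *)
Lemma directions_total A x : \det A != 0 -> x != 0 ->
  exists2 v, v \in directions A & dotv v x != 0.
Proof.
move=> A0 x0; have Au : A^T \in unitmx by rewrite unitmx_tr unitmxE unitfE.
have [i xi] : exists i, (A^T *m x) i 0 != 0.
  apply/existsP; apply: contraNT x0; rewrite negb_exists => /forallP h.
  rewrite -(mulKmx Au x); suff -> : A^T *m x = 0 by rewrite mulmx0.
  by apply/colP => i; rewrite [RHS]mxE; apply/eqP/negPn.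
have ix : dotv (A *m delta_mx i 0) x = (A^T *m x) i 0.
  by rewrite -colE mxE; apply: eq_bigr => j _; rewrite !mxE.
exists (A *m delta_mx i 0); last by rewrite ix.
rewrite !inE; apply/andP; split.
  by apply: contraNneq xi => Ai; rewrite -ix Ai dotvC dotv0r.
apply/imfsetP; exists (delta_mx i 0) => //=; apply/vec_overP => j.
by rewrite mxE eqxx andbT !inE; case: (j == i); rewrite ?mulr1n ?mulr0n eqxx ?orbT.
Qed.

(** Carries the nonnegativity of [betaV], assumed on each [directions_k], over to [directions]. *)
Lemma directions_directions_k A nu : nu \in directions A ->
  exists2 k, (1 <= k <= d)%N & nu \in directions_k A k.
Proof.
rewrite !inE => /andP[nu0 /imfsetP[t /= tT nuE]].
exists #|[set i | t i ord0 != 0]%SET|; last first.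
  by apply/imfsetP; exists t => //; rewrite inE /= tT /=.
rewrite (leq_trans (max_card _)) ?card_ord // andbT card_gt0.
apply: contraNneq nu0 => t0; rewrite nuE.
suff -> : t = 0 by rewrite mulmx0.
apply/colP => i; rewrite mxE; apply/eqP/negPn.
by have := finset.in_set0 i; rewrite -t0 inE => ->.
Qed.

Lemma surface_energyZ A b (c : R) x :
  surface_energy A b (c *: x) = `|c| * surface_energy A b x.
Proof.
rewrite /surface_energy big_distrr; apply: eq_bigr => v _.
by rewrite dotvZr normrM mulrCA.
Qed.

Lemma surface_energy_ge0 A b x :
  {in directions A, forall v, 0 <= b v} -> 0 <= surface_energy A b x.
Proof.
move=> b0; rewrite /surface_energy big_seq sumr_ge0 // => v /b0 bv.
by rewrite mulr_ge0.
Qed.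

(** The ratio is invariant under scaling, so every point of finite ratio can be moved to the
    hyperplane, where the ratio is the energy. *)
Lemma beta_A_min A b z : dotv (e1 R d) z = 1 ->
  (forall x, dotv (e1 R d) x = 1 -> surface_energy A b z <= surface_energy A b x) ->
  beta_A A b = surface_energy A b z.
Proof.
move=> ez zmin; rewrite /beta_A.
suff -> : ereal_inf [set energy_ratio A b xi | xi in [set xi | xi != 0]] =
  (surface_energy A b z)%:E by [].
apply/eqP; rewrite eq_le; apply/andP; split.
  apply: ereal_inf_lbound; exists z.
    by apply: contra_eq_neq ez => ->; rewrite dotv0r eq_sym oner_neq0.
  by rewrite /energy_ratio ez oner_eq0 normr1 divr1.
apply: le_ereal_inf_tmp => _ [x _ <-]; rewrite /energy_ratio.
case: eqP => [_|/eqP ex]; first by rewrite leey.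
have <- : surface_energy A b ((dotv (e1 R d) x)^-1 *: x) =
    surface_energy A b x / `|dotv (e1 R d) x|.
  by rewrite surface_energyZ normfV mulrC.
by rewrite lee_fin zmin // dotvZr mulVf.
Qed.

(** As [e1] is not orthogonal to [z], it lies outside the span of the directions orthogonal to [z];
    together they fill the space, so that span has dimension [d.-1]. *)
Lemma cryst_normals_vertex A z :
  dotv (e1 R d) z = 1 ->
  <<e1 R d :: [seq v <- directions A | dotv v z == 0%R]>>%VS = fullv ->
  cryst_normals A ((enorm z)^-1 *: z).
Proof.
move=> ez full.
have z0 : z != 0.
  by apply: contra_eq_neq ez => ->; rewrite dotv0r eq_sym oner_neq0.
split; first exact: enorm_normalize.
have [t [tN tf tE]] := span_free_subseq [seq v <- directions A | dotv v z == 0%R].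
have tz : {in t, forall v, dotv v z = 0}.
  by move=> v /tN; rewrite mem_filter => /andP[/eqP].
have et : free (e1 R d :: t).
  rewrite free_cons tf andbT; apply/negP => /(span_orthogonal tz)/eqP.
  by rewrite ez oner_eq0.
have fullt : <<e1 R d :: t>>%VS = fullv by rewrite span_cons tE -span_cons.
have size_t : size t == d.-1.
  have /eqP := et; rewrite fullt dimvf /dim /= muln1 => dE.
  by rewrite -[size t]/((size t).+1.-1) -dE.
exists (Tuple size_t) => [v /tN|]; first by rewrite mem_filter => /andP[].
apply/seteqP; split=> w /=.
  by rewrite dotvZr => /(span_orthogonal tz) ->; rewrite mulr0.
rewrite dotvZr => /eqP; rewrite mulf_eq0 invr_eq0 gt_eqF ?enorm_gt0 //= => /eqP wz.
(* Write [w] as a multiple of [e1] plus a vector of the span of [t]; pairing with [z] kills the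
   coefficient of [e1]. *)
have: w \in <<e1 R d :: t>>%VS by rewrite fullt memvf.
rewrite span_cons => /memv_addP[_ /vlineP[c ->] [y yt wE]].
move: wz; rewrite wE dotvC dotvDr dotvZr ![dotv z _]dotvC ez.
by rewrite (span_orthogonal tz yt) mulr1 addr0 => ->; rewrite scale0r add0r.
Qed.

End Directions.

Theorem lemma3p3 (R : realType) (d : nat) (hd : (2 <= d)%N)
  (A : 'M[R]_d) (hA : 0 < \det A)
  (betaZ : 'cV[R]_d -> 'cV[R]_d -> R) (betaV : 'cV[R]_d -> R)
  (betaZ_sym : forall zs zt : 'cV[R]_d, zs \in corners A -> zt \in corners A ->
     zs != zt -> betaZ zs zt = betaZ zt zs)
  (betaZ_ge0 : forall zs zt : 'cV[R]_d, zs \in corners A -> zt \in corners A ->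
     zs != zt -> 0 <= betaZ zs zt)
  (betaZ_partition : forall P : {set {set corners A}},
     finset.partition P [set: corners A]%SET -> (2 <= #|P|)%N ->
     0 < \sum_(B in P) \sum_(C in P | C != B)
           \sum_(zs in B) \sum_(zt in C) betaZ (val zs) (val zt))
  (betaV_ge0 : forall (k : nat) (nu : 'cV[R]_d), (1 <= k <= d)%N -> nu \in directions_k A k ->
     0 <= betaV nu)
  (betaV_betaZ : forall (k : nat) (nu : 'cV[R]_d), (1 <= k <= d)%N -> nu \in directions_k A k ->
     forall zs zt : 'cV[R]_d, zs \in corners A -> zt \in corners A -> zs - zt = nu ->
     1 / 2 * betaZ zs zt = 2 ^ (k%:Z - d%:Z) * betaV nu) :
  exists2 xi : 'cV[R]_d, cryst_normals A xi &
    Lambda A betaV xi = 0 /\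
    (forall s : 'cV[R]_d, sphere s -> Lambda A betaV xi <= Lambda A betaV s).
Proof.
set e := e1 R d.
have e0 : e != 0.
  apply/eqP => /colP/(_ (Ordinal (ltnW hd))); rewrite !mxE eqxx => /eqP.
  by rewrite oner_eq0.
have b_ge0 : {in directions A, forall v, 0 <= betaV v}.
  by move=> v /directions_directions_k[k kd]; apply: betaV_ge0.
have total x := @directions_total R d A x (lt0r_neq0 hA).
have [z [ez full] zmin] := exists_min_vertex b_ge0 total e0.
have betaE : beta_A A betaV = surface_energy A betaV z := beta_A_min ez zmin.
have Lz : Lambda A betaV ((enorm z)^-1 *: z) = 0.
  rewrite /Lambda betaE surface_energyZ dotvZr ez mulr1.
  by rewrite subrr mul0r.
exists ((enorm z)^-1 *: z); first exact: cryst_normals_vertex.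
split=> // s _; rewrite Lz /Lambda divr_ge0 ?sqrtr_ge0 // subr_ge0.
have [->|es] := eqVneq (dotv e s) 0.
  by rewrite normr0 mul0r surface_energy_ge0.
(* Dividing by the absolute value of [dotv e s] reduces the bound to the minimality of [z] at the
   rescaled [s]. *)
rewrite betaE -ler_pdivlMl ?normr_gt0 // -normfV -surface_energyZ.
by apply: zmin; rewrite dotvZr mulVf.
Qed.
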